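(* Suppose $\mathscr{L}$ is a variadic language with no predicate symbols, containing (possibly among other things) binary function symbols $\leq$, $+$ and $\delta$, and a variadic function symbol $G$. Suppose $\mathscr{M}$ is an $\mathscr{L}$-structure which interprets $+$ as addition and interprets $\leq$, $\delta$, and $G$ by \[ \leq^{\mathscr{M}}(m,n)=\begin{cases}1&\text{if } m\leq n,\\0&\text{otherwise,}\end{cases}\qquad \delta^{\mathscr{M}}(m,n)=\begin{cases}1&\text{if } m=n,\\0&\text{otherwise,}\end{cases} \] \[ G^{\mathscr{M}}(m_0,\ldots,m_n)=\begin{cases}1&\text{if } m_i\neq 0\text{ for some }0\leq i\leq n,\\0&\text{otherwise.}\end{cases} \] Then for any unbounded-quantifier-free (uqf) $\mathscr{L}$-formula $\phi$, there is a quantifier-free $\mathscr{L}$-formula $\psi$, with the same free variables as $\phi$, such that $\mathscr{M}\models\phi\leftrightarrow\psi$.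
   Context: $\mathbb{N}=\{0,1,2,\dots\}$ and $\mathbb{N}^{<\mathbb{N}}$ is the set of finite sequences of naturals. Variadic language: a first-order language, including a constant symbol $\mathbf{n}$ for every $n\in\mathbb{N}$, together with a set of variadic function symbols, and a special symbol $\cdots_x$ for every variable $x$. Every language is assumed to satisfy: (1) every symbol is exactly one of: a left parenthesis, a right parenthesis, a logical connective, $=$, a constant symbol, a variable, an $n$-ary predicate symbol for some $n$, an $n$-ary function symbol for some $n$, a variadic function symbol, or an ellipsis $\cdots_x$ for some variable $x$; (2) if a symbol is an $n$-ary function (resp. predicate) symbol and an $m$-ary function (resp. predicate) symbol then $n=m$; (3) if a symbol is both $\cdots_x$ and $\cdots_y$ then $x$ and $y$ are the same variable. (So terms are uniquely readable.) Structure for $\mathscr{L}$: a structure $\mathscr{M}$ for the first-order part of $\mathscr{L}$, with universe $\mathbb{N}$, interpreting each $\mathbf{n}$ as $n$, together with a function $H^{\mathscr{M}}:\mathbb{N}^{<\mathbb{N}}\to\mathbb{N}$ for every variadic function symbol $H$. For $n\in\mathbb{N}$, $\overline{n}$ also denotes the constant symbol $\mathbf{n}$. Terms and their free variables: a constant symbol $c$ is a term, $FV(c)=\emptyset$; a variable $x$ is a term, $FV(x)=\{x\}$; if $f$ is an $n$-ary or variadic function symbol and $u_1,\dots,u_n$ are terms then $f(u_1,\dots,u_n)$ is a term with free variables $FV(u_1)\cup\cdots\cup FV(u_n)$; if $H$ is a variadic function symbol, $u,v$ are terms and $x$ is a variable then $H(u(\mathbf{0})\cdots_x u(v))$ is a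 term (a purely formal expression built from $H,u,x,v$) with free variables $(FV(u)\setminus\{x\})\cup FV(v)$. Term substitution $r(x|t)$ (substituting $t$ for $x$ in $r$): $c(x|t)=c$ for constants; $x(x|t)=t$; $y(x|t)=y$ for variables $y\neq x$; $f(u_1,\dots,u_n)(x|t)=f(u_1(x|t),\dots,u_n(x|t))$; if $r$ is $H(u(\mathbf{0})\cdots_x u(v))$ then $r(x|t)$ is $H(u(\mathbf{0})\cdots_x u(v(x|t)))$; if $r$ is $H(u(\mathbf{0})\cdots_y u(v))$ with $y\neq x$ then $r(x|t)$ is $H(u(x|t)(\mathbf{0})\cdots_y u(x|t)(v(x|t)))$. Assignment: a function $s$ from variables to $\mathbb{N}$; $s(x|n)$ is the assignment agreeing with $s$ except that it maps $x$ to $n$. Interpretation $t^s\in\mathbb{N}$ of a term, by recursion on complexity: $c^s=c^{\mathscr{M}}$; $x^s=s(x)$; $f(u_1,\dots,u_k)^s=f^{\mathscr{M}}(u_1^s,\dots,u_k^s)$; and $H(u(\mathbf{0})\cdots_x u(v))^s=H^{\mathscr{M}}(u(x|\mathbf{0})^s,u(x|\mathbf{1})^s,\dots,u(x|\overline{v^s})^s)$, a sequence of $v^s+1$ arguments. Formulas are first-order formulas built from equations between terms; $\mathscr{M}\models(u=v)[s]$ iff $u^s=v^s$, and satisfaction of other formulas is defined inductively as in ordinary first-order logic; $\mathscr{M}\models\phi$ means $\mathscr{M}\models\phi[s]$ for every assignment $s$. $u\leq v$ abbreviates the formula $\leq(u,v)=\mathbf{1}$. Quantifier-free formulas: atomic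 formulas, closed under $\wedge,\vee,\rightarrow,\leftrightarrow,\neg$. Unbounded-quantifier-free (uqf) formulas, defined inductively: every atomic formula is uqf; if $\phi,\psi$ are uqf and $x,y$ are distinct variables then $\phi\wedge\psi$, $\phi\vee\psi$, $\phi\rightarrow\psi$, $\phi\leftrightarrow\psi$, $\neg\phi$, $\exists x\,(x\leq y\wedge\phi)$ and $\forall x\,(x\leq y\rightarrow\phi)$ are uqf. *)

(* Defs.v *)
From HB Require Import structures.
From mathcomp Require Import all_boot finmap.

Set Implicit Arguments.
Unset Strict Implicit.
Unset Printing Implicit Defensive.

Local Open Scope nat_scope.
Local Open Scope fset_scope.

(* The kinds of symbols are separate types, and the function and predicate    *)
(* symbols are indexed by their arity, so that each symbol has exactly one    *)
(* kind and one arity, and terms are uniquely readable. The ellipsis symbols  *)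
(* are the constructor [TEll] of terms below, applied to a variable.          *)
Record language := Language {
  cstsym : Type;
  numeral : nat -> cstsym;
  funsym : nat -> Type;
  relsym : nat -> Type;
  varsym : Type  (* variadic function symbols *)
}.

Definition var := nat.

(* [T ^ n] is the type of finite functions {ffun 'I_n -> T}.                  *)
(* [TEll H u x v] is the formal expression H(u(0) ..._x u(v)).                *)
Inductive term (L : language) : Type :=
| TCst (c : cstsym L)
| TVar (x : var)
| TFun (n : nat) (f : funsym L n) (us : term L ^ n)
| TVrd (H : varsym L) (us : seq (term L))
| TEll (H : varsym L) (u : term L) (x : var) (v : term L).

Arguments TCst {L} c.
Arguments TVar {L} x.

Definition TNum {L : language} (n : nat) : term L := TCst (numeral L n).

Definition TFun2 (L : language) (f : funsym L 2) (u v : term L) : term L :=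
  TFun f [ffun i : 'I_2 => tnth [tuple u; v] i].

Fixpoint tFV (L : language) (t : term L) : {fset var} :=
  match t with
  | TCst _ => fset0
  | TVar x => [fset x]
  | TFun n _ us => \big[fsetU/fset0]_(i < n) tFV (us i)
  | TVrd _ us => foldr (fun u A => tFV u `|` A) fset0 us
  | TEll _ u x v => (tFV u `\ x) `|` tFV v
  end.

(* [tsubst x t r] is r(x|t). Bound variables are not renamed, so variables    *)
(* of [t] may be captured; interpretation only substitutes constants.         *)
Fixpoint tsubst (L : language) (x : var) (t r : term L) : term L :=
  match r with
  | TCst c => TCst c
  | TVar y => if y == x then t else TVar y
  | TFun n f us => TFun f [ffun i => tsubst x t (us i)]
  | TVrd H us => TVrd H [seq tsubst x t u | u <- us]
  | TEll H u y v =>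
      if y == x then TEll H u y (tsubst x t v)
      else TEll H (tsubst x t u) y (tsubst x t v)
  end.

(* The universe is [nat], and the constant symbol n denotes n. *)
Record structure (L : language) := Structure {
  cstM : cstsym L -> nat;
  funM : forall n, funsym L n -> n.-tuple nat -> nat;
  relM : forall n, relsym L n -> n.-tuple nat -> Prop;
  varM : varsym L -> seq nat -> nat;
  cstM_numeral : forall n, cstM (numeral L n) = n
}.

Definition assignment := var -> nat.

Definition update (s : assignment) (x : var) (n : nat) : assignment :=
  fun y => if y == x then n else s y.

Fixpoint height (L : language) (t : term L) : nat :=
  match t with
  | TCst _ | TVar _ => 1
  | TFun n _ us => (\max_(i < n) height (us i)).+1
  | TVrd _ us => (foldr maxn 0 [seq height u | u <- us]).+1
  | TEll _ u _ v => (maxn (height u) (height v)).+1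
  end.

(* The interpretation of H(u(0) ..._x u(v)) calls itself on the terms         *)
(* u(x|k), which are not subterms but have the same height as u. The          *)
(* recursion is therefore on a bound [d] on the height of the term; the       *)
(* equations [interp_cst], ..., [interp_ell] below show that the bound plays  *)
(* no role in [interp].                                                       *)
Fixpoint interp_upto (L : language) (M : structure L) (d : nat)
    (s : assignment) (t : term L) : nat :=
  if d is d'.+1 then
    match t with
    | TCst c => cstM M c
    | TVar x => s x
    | TFun n f us => funM M f [tuple interp_upto M d' s (us i) | i < n]
    | TVrd H us => varM M H [seq interp_upto M d' s u | u <- us]
    | TEll H u x v =>
        varM M H [seq interp_upto M d' s (tsubst x (TNum k) u)
                 | k <- iota 0 (interp_upto M d' s v).+1]
    end
  else 0.

Definition interp (L : language) (M : structure L) (s : assignment)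
    (t : term L) : nat := interp_upto M (height t) s t.

Inductive formula (L : language) : Type :=
| FEq (u v : term L)
| FRel (n : nat) (P : relsym L n) (us : term L ^ n)
| FNot (phi : formula L)
| FAnd (phi psi : formula L)
| FOr (phi psi : formula L)
| FImp (phi psi : formula L)
| FIff (phi psi : formula L)
| FEx (x : var) (phi : formula L)
| FAll (x : var) (phi : formula L).

Fixpoint FV (L : language) (phi : formula L) : {fset var} :=
  match phi with
  | FEq u v => tFV u `|` tFV v
  | FRel n _ us => \big[fsetU/fset0]_(i < n) tFV (us i)
  | FNot phi => FV phi
  | FAnd phi psi | FOr phi psi | FImp phi psi | FIff phi psi =>
      FV phi `|` FV psi
  | FEx x phi | FAll x phi => FV phi `\ x
  end.

Fixpoint sat (L : language) (M : structure L) (s : assignment)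
    (phi : formula L) : Prop :=
  match phi with
  | FEq u v => interp M s u = interp M s v
  | FRel n P us => relM M P [tuple interp M s (us i) | i < n]
  | FNot phi => ~ sat M s phi
  | FAnd phi psi => sat M s phi /\ sat M s psi
  | FOr phi psi => sat M s phi \/ sat M s psi
  | FImp phi psi => sat M s phi -> sat M s psi
  | FIff phi psi => sat M s phi <-> sat M s psi
  | FEx x phi => exists n, sat M (update s x n) phi
  | FAll x phi => forall n, sat M (update s x n) phi
  end.

Definition models (L : language) (M : structure L) (phi : formula L) : Prop :=
  forall s : assignment, sat M s phi.

Definition atomic (L : language) (phi : formula L) : bool :=
  match phi with
  | FEq _ _ | FRel _ _ _ => true
  | _ => false
  end.

Inductive quantifier_free (L : language) : formula L -> Prop :=
| QF_atomic phi : atomic phi -> quantifier_free phi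
| QF_not phi : quantifier_free phi -> quantifier_free (FNot phi)
| QF_and phi psi : quantifier_free phi -> quantifier_free psi ->
    quantifier_free (FAnd phi psi)
| QF_or phi psi : quantifier_free phi -> quantifier_free psi ->
    quantifier_free (FOr phi psi)
| QF_imp phi psi : quantifier_free phi -> quantifier_free psi ->
    quantifier_free (FImp phi psi)
| QF_iff phi psi : quantifier_free phi -> quantifier_free psi ->
    quantifier_free (FIff phi psi).

(* The abbreviation u <= v; it depends on the symbol [le]. *)
Definition FLe (L : language) (le : funsym L 2) (u v : term L) : formula L :=
  FEq (TFun2 le u v) (TNum 1).

Inductive uqf (L : language) (le : funsym L 2) : formula L -> Prop :=
| UQF_atomic phi : atomic phi -> uqf le phi
| UQF_not phi : uqf le phi -> uqf le (FNot phi)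
| UQF_and phi psi : uqf le phi -> uqf le psi -> uqf le (FAnd phi psi)
| UQF_or phi psi : uqf le phi -> uqf le psi -> uqf le (FOr phi psi)
| UQF_imp phi psi : uqf le phi -> uqf le psi -> uqf le (FImp phi psi)
| UQF_iff phi psi : uqf le phi -> uqf le psi -> uqf le (FIff phi psi)
| UQF_ex x y phi : x <> y -> uqf le phi ->
    uqf le (FEx x (FAnd (FLe le (TVar x) (TVar y)) phi))
| UQF_all x y phi : x <> y -> uqf le phi ->
    uqf le (FAll x (FImp (FLe le (TVar x) (TVar y)) phi)).

(* The induction principle generated by Rocq has no induction hypothesis for  *)
(* the arguments of [TFun] and [TVrd].                                        *)
Fixpoint all_prop (T : Type) (P : T -> Prop) (us : seq T) : Prop :=
  if us is u :: us' then P u /\ all_prop P us' else True.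

Lemma term_nested_ind (L : language) (P : term L -> Prop) :
  (forall c, P (TCst c)) ->
  (forall x, P (TVar x)) ->
  (forall n (f : funsym L n) (us : term L ^ n),
     (forall i, P (us i)) -> P (TFun f us)) ->
  (forall (H : varsym L) us, all_prop P us -> P (TVrd H us)) ->
  (forall (H : varsym L) u x v, P u -> P v -> P (TEll H u x v)) ->
  forall t, P t.
Proof.
move=> Pc Px Pf Pv Pe; fix IH 1; case.
- exact: Pc.
- exact: Px.
- by move=> n f us; apply: Pf => i; apply: IH.
- move=> H us; apply: Pv; elim: us => [|u us IHus]; first exact: I.
  exact: conj (IH u) IHus.
- by move=> H u x v; apply: Pe; apply: IH.
Qed.

Lemma height_tsubst_cst (L : language) (x : var) (c : cstsym L) (t : term L) :
  height (tsubst x (TCst c) t) = height t.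
Proof.
elim/term_nested_ind: t => //=.
- by move=> y; case: eqP.
- by move=> n f us IH; congr _.+1; apply: eq_bigr => i _; rewrite ffunE IH.
- move=> H us IH; congr _.+1; elim: us IH => //= u us IHus [-> /IHus].
  by move=> ->.
- by move=> H u y v IHu IHv; case: eqP => _ /=; rewrite ?IHu IHv.
Qed.

Lemma interp_uptoE (L : language) (M : structure L) (d : nat) (s : assignment)
    (t : term L) : height t <= d -> interp_upto M d s t = interp M s t.
Proof.
suff main d1 d2 u : height u <= d1 -> height u <= d2 ->
    interp_upto M d1 s u = interp_upto M d2 s u by move=> le_td; apply: main.
elim: d1 d2 u => [|d1 IH] [|d2] u; try by case: u.
case: u => //=.
- move=> n f us; rewrite !ltnS => /bigmax_leqP h1 /bigmax_leqP h2.
  congr (funM M f _); apply: eq_mktuple => i.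
  by apply: IH; [apply: h1 | apply: h2].
- move=> H us; rewrite !ltnS => h1 h2; congr (varM M H _).
  elim: us h1 h2 => //= u us IHus; rewrite !geq_max.
  by case/andP=> a1 b1 /andP[a2 b2]; rewrite (IH d2) // IHus.
- move=> H u x v; rewrite !ltnS !geq_max => /andP[u1 v1] /andP[u2 v2].
  have IHu k : interp_upto M d1 s (tsubst x (TNum k) u) =
               interp_upto M d2 s (tsubst x (TNum k) u).
    by apply: IH; rewrite height_tsubst_cst.
  by rewrite (IH d2 v) // IHu (eq_map IHu).
Qed.

Lemma interp_cst (L : language) (M : structure L) (s : assignment)
    (c : cstsym L) : interp M s (TCst c) = cstM M c.
Proof. by []. Qed.

Lemma interp_var (L : language) (M : structure L) (s : assignment) (x : var) :
  interp M s (TVar x) = s x.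
Proof. by []. Qed.

Lemma interp_fun (L : language) (M : structure L) (s : assignment)
    (n : nat) (f : funsym L n) (us : term L ^ n) :
  interp M s (TFun f us) = funM M f [tuple interp M s (us i) | i < n].
Proof.
rewrite {1}/interp /=; congr (funM M f _); apply: eq_mktuple => i.
by apply: interp_uptoE; apply: (@leq_bigmax _ (fun i : 'I_n => height (us i)) i).
Qed.

Lemma interp_vrd (L : language) (M : structure L) (s : assignment)
    (H : varsym L) (us : seq (term L)) :
  interp M s (TVrd H us) = varM M H [seq interp M s u | u <- us].
Proof.
rewrite {1}/interp /=; congr (varM M H _).
suff main d : foldr maxn 0 [seq height u | u <- us] <= d ->
    [seq interp_upto M d s u | u <- us] = [seq interp M s u | u <- us].
  exact: main.
elim: us => //= u us IH; rewrite geq_max => /andP[le_u le_us].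
by rewrite interp_uptoE // IH.
Qed.

Lemma interp_ell (L : language) (M : structure L) (s : assignment)
    (H : varsym L) (u : term L) (x : var) (v : term L) :
  interp M s (TEll H u x v) =
  varM M H [seq interp M s (tsubst x (TNum k) u)
           | k <- iota 0 (interp M s v).+1].
Proof.
rewrite {1}/interp /=.
have Eu k : interp_upto M (maxn (height u) (height v)) s (tsubst x (TNum k) u) =
            interp M s (tsubst x (TNum k) u).
  by apply: interp_uptoE; rewrite height_tsubst_cst leq_maxl.
by rewrite (interp_uptoE _ _ (leq_maxr _ _)) Eu (eq_map Eu).
Qed.

(* Main.v *)
Require Import Defs.
From mathcomp Require Import all_boot finmap.

(** The proof computes truth values inside the terms. For every uqf formula
    there is a term with the same free variables whose value, under each
    assignment, is the truth value of the formula, coded as 0 or 1 (the relation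
    [indicates] below); the quantifier-free formula is then the single equation
    saying that this term equals 1.

    On truth values, [delta] is equality, [le] is implication and [+] counts
    how many of its arguments are true, so every connective is the value of a
    term built from these. A bounded existential quantifier is a
    disjunction of variable length, which is precisely what an ellipsis under
    [G] evaluates: if [t] indicates [phi], then G(t(0) ..._x t(y)) is 1 exactly
    when [t] takes the value 1 for some value of [x] up to that of [y]
    ([indicates_ex]). The bounded universal quantifier is its dual.

    Evaluating the ellipsis requires the substitution lemma
    ([interp_tsubst_num]): substituting a numeral in a term amounts to updating
    the assignment. *)

Set Implicit Arguments.
Unset Strict Implicit.
Unset Printing Implicit Defensive.

Local Open Scope fset_scope.

(** The induction is on the height and not on the structure of the term: below
    an ellipsis binding [y] the claim is needed for the argument [u] and also
    for its instances [u(x|k)], which are not subterms. Taking any [s']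
    pointwise equal to [update s x k] lets updates be reordered without
    functional extensionality. *)
Lemma interp_tsubst_num_ext (L : language) (M : structure L) (x : var)
    (k : nat) (t : term L) (s s' : assignment) :
  s' =1 update s x k -> interp M s (tsubst x (TNum k) t) = interp M s' t.
Proof.
have [d] := ubnP (height t); elim: d => // d IH in t x k s s' *.
case: t => [c|y|n f us|H us|H u y v] /=; rewrite ?ltnS => ht Es.
- by [].
- rewrite interp_var Es /update; case: eqP => _ //.
  by rewrite interp_cst cstM_numeral.
- rewrite !interp_fun; congr (funM M f _); apply: eq_mktuple => i.
  rewrite ffunE; apply: IH => //.
  exact: leq_ltn_trans (@leq_bigmax _ (fun i => height (us i)) i) ht.
- rewrite !interp_vrd -map_comp; congr (varM M H _).
  elim: us ht => //= u us IHus; rewrite gtn_max => /andP[hu hus].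
  by rewrite IHus // (IH u _ _ _ s').
- move: ht; rewrite gtn_max => /andP[hu hv].
  have [Exy | nxy] := eqVneq y x; rewrite !interp_ell (IH v x k s s') //.
    (* [x] is rebound by the ellipsis, which hides its former value. *)
    congr (varM M H _); apply: eq_map => j; rewrite Exy.
    rewrite (IH u x j s (update s x j)) // (IH u x j s' (update s x j)) // => z.
    by rewrite /update; case: eqP => // /eqP zx; rewrite Es /update (negbTE zx).
  congr (varM M H _); apply: eq_map => j.
  rewrite (IH _ y j s (update s y j)) ?height_tsubst_cst //.
  rewrite (IH u x k _ (update s' y j)) //; first exact/esym/IH.
  move=> z; rewrite /update Es /update.
  by case: (eqVneq z y) => [->|//]; rewrite (negbTE nxy).
Qed.

Lemma interp_tsubst_num (L : language) (M : structure L) (x : var)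
    (k : nat) (t : term L) (s : assignment) :
  interp M s (tsubst x (TNum k) t) = interp M (update s x k) t.
Proof. exact: interp_tsubst_num_ext. Qed.

Lemma interp_num (L : language) (M : structure L) (s : assignment) (n : nat) :
  interp M s (TNum n) = n.
Proof. exact: cstM_numeral. Qed.

Lemma interp_fun2 (L : language) (M : structure L) (s : assignment)
    (f : funsym L 2) (u v : term L) :
  interp M s (TFun2 f u v) = funM M f [tuple interp M s u; interp M s v].
Proof.
rewrite interp_fun; congr (funM M f _); apply: eq_from_tnth => i.
by rewrite tnth_mktuple ffunE; case: i => [[|[|]]].
Qed.

Lemma tFV_fun2 (L : language) (f : funsym L 2) (u v : term L) :
  tFV (TFun2 f u v) = tFV u `|` tFV v.
Proof. by rewrite /= !big_ord_recl big_ord0 !ffunE /= fsetU0. Qed.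

(** Demanding the values 0 and 1, rather than zero and nonzero, is what lets
    [le], [+] and [delta] act as connectives. The boolean also makes
    satisfaction of [phi] decidable, so that the universal quantifier can be
    dualized constructively. *)
Definition indicates (L : language) (M : structure L) (t : term L)
    (phi : formula L) : Prop :=
  tFV t = FV phi /\
  forall s, exists2 b : bool, interp M s t = b & (sat M s phi <-> b).

Section Indicators.

Context (L : language) (M : structure L) (le plus delta : funsym L 2).
Context (G : varsym L).
Context (plusM : forall m n : nat, funM M plus [tuple m; n] = (m + n)%N).
Context (leM : forall m n : nat,
  funM M le [tuple m; n] = if (m <= n)%N then 1%N else 0%N).
Context (deltaM : forall m n : nat,
  funM M delta [tuple m; n] = if m == n then 1%N else 0%N).
Context (GM : forall (m0 : nat) (ms : seq nat),
  varM M G (m0 :: ms) =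
  if has (fun m => m != 0%N) (m0 :: ms) then 1%N else 0%N).

Implicit Types (t u v : term L) (phi psi : formula L).

Lemma indicates_equiv t phi psi : FV phi = FV psi ->
  (forall s, sat M s phi <-> sat M s psi) ->
  indicates M t phi -> indicates M t psi.
Proof.
move=> EFV Esat [Et it]; split=> [|s]; first by rewrite Et.
by have [b Eb Pb] := it s; exists b => //; rewrite -Esat.
Qed.

Lemma indicates_eq u v : indicates M (TFun2 delta u v) (FEq u v).
Proof.
split=> [|s]; first exact: tFV_fun2.
rewrite interp_fun2 deltaM; exists (interp M s u == interp M s v).
  by case: eqP.
by split=> /eqP.
Qed.

Lemma indicates_not t phi :
  indicates M t phi -> indicates M (TFun2 delta t (TNum 0)) (FNot phi).
Proof.
case=> Et it; split=> [|s]; first by rewrite tFV_fun2 /= fsetU0.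
rewrite interp_fun2 deltaM interp_num; have [b -> Pb] := it s.
by exists (~~ b); [case: (b) | rewrite /= Pb; split=> /negP].
Qed.

(** Both conjuncts are true when the sum of their truth values is 2. *)
Lemma indicates_and t u phi psi :
  indicates M t phi -> indicates M u psi ->
  indicates M (TFun2 delta (TFun2 plus t u) (TNum 2)) (FAnd phi psi).
Proof.
move=> [Et it] [Eu iu]; split=> [|s].
  by rewrite !tFV_fun2 Et Eu /= fsetU0.
rewrite !interp_fun2 deltaM plusM interp_num.
have [b -> Pb] := it s; have [c -> Pc] := iu s.
exists (b && c); first by case: (b) (c) => [] [].
by rewrite /= Pb Pc; split=> /andP.
Qed.

Lemma indicates_or t u phi psi :
  indicates M t phi -> indicates M u psi ->
  indicates M (TFun2 le (TNum 1) (TFun2 plus t u)) (FOr phi psi).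
Proof.
move=> [Et it] [Eu iu]; split=> [|s].
  by rewrite !tFV_fun2 Et Eu /= fset0U.
rewrite !interp_fun2 leM plusM interp_num.
have [b -> Pb] := it s; have [c -> Pc] := iu s.
exists (b || c); first by case: (b) (c) => [] [].
by rewrite /= Pb Pc; split=> /orP.
Qed.

Lemma indicates_imp t u phi psi :
  indicates M t phi -> indicates M u psi ->
  indicates M (TFun2 le t u) (FImp phi psi).
Proof.
move=> [Et it] [Eu iu]; split=> [|s]; first by rewrite tFV_fun2 Et Eu.
rewrite interp_fun2 leM; have [b -> Pb] := it s; have [c -> Pc] := iu s.
exists (b ==> c); first by case: (b) (c) => [] [].
by rewrite /= Pb Pc; split=> /implyP.
Qed.

Lemma indicates_iff t u phi psi :
  indicates M t phi -> indicates M u psi ->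
  indicates M (TFun2 delta t u) (FIff phi psi).
Proof.
move=> [Et it] [Eu iu]; split=> [|s]; first by rewrite tFV_fun2 Et Eu.
rewrite interp_fun2 deltaM; have [b -> Pb] := it s; have [c -> Pc] := iu s.
exists (b == c); first by case: (b) (c) => [] [].
by rewrite /= Pb Pc; split=> [[bc cb] | /eqP ->] //; apply/eqP; apply/idP/idP.
Qed.

Lemma sat_le_var s (x y : var) :
  sat M s (FLe le (TVar x) (TVar y)) <-> (s x <= s y)%N.
Proof. by rewrite /= interp_fun2 leM interp_num !interp_var; case: ifP. Qed.

(** The condition [x <> y] keeps the bound [y] free in the formula and its
    value unaffected by the value given to [x]. *)
Lemma indicates_ex t phi (x y : var) : x <> y ->
  indicates M t phi ->
  indicates M (TEll G t x (TVar y))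
    (FEx x (FAnd (FLe le (TVar x) (TVar y)) phi)).
Proof.
move=> /eqP nxy [Et it]; split=> [|s].
  rewrite -[RHS]/((tFV (TFun2 le (TVar x) (TVar y)) `|` fset0 `|` FV phi) `\ x).
  rewrite tFV_fun2 -Et /= fsetU0.
  apply/fsetP=> z; rewrite !inE.
  by case: (eqVneq z x) => [->|] /=; rewrite ?(negbTE nxy) ?orbF 1?orbC.
have tval n : sat M (update s x n) phi <-> interp M (update s x n) t != 0.
  by have [b -> ->] := it (update s x n); case: (b).
have bound n : sat M (update s x n) (FLe le (TVar x) (TVar y)) <-> n <= s y.
  by rewrite sat_le_var /update eqxx eq_sym (negbTE nxy).
rewrite interp_ell interp_var.
exists (has (fun n => interp M (update s x n) t != 0) (iota 0 (s y).+1)).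
  (* An ellipsis always has at least the argument for 0. *)
  rewrite [map _ _]/= GM -[_ :: _]/(map _ (iota 0 (s y).+1)) has_map.
  rewrite (@eq_has _ _ (fun n => interp M (update s x n) t != 0)); last first.
    by move=> n /=; rewrite interp_tsubst_num.
  by case: has.
split=> [[n [/bound le_n /tval tn]] | /hasP[n le_n /tval tn]].
  by apply/hasP; exists n => //; rewrite mem_iota ltnS.
exists n; split=> //; apply/bound.
by rewrite mem_iota ltnS in le_n.
Qed.

Lemma indicates_all t phi (x y : var) : x <> y ->
  indicates M t phi ->
  indicates M
    (TFun2 delta (TEll G (TFun2 delta t (TNum 0)) x (TVar y)) (TNum 0))
    (FAll x (FImp (FLe le (TVar x) (TVar y)) phi)).
Proof.
move=> nxy it.
apply: indicates_equiv (indicates_not (indicates_ex nxy (indicates_not it))) => //.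
move=> s; split=> [noex n le_n | all_n [n [le_n]]]; last by apply; apply: all_n.
have [[] _ Pb] := it.2 (update s x n); first exact/Pb.
by case: noex; exists n; split=> // /Pb.
Qed.

Lemma uqf_indicated phi : (forall n, relsym L n -> False) ->
  uqf le phi -> exists t, indicates M t phi.
Proof.
move=> no_relsym; elim=> {phi}.
- case=> // [u v _ | n /no_relsym //].
  by exists (TFun2 delta u v); apply: indicates_eq.
- by move=> phi _ [t it]; eexists; apply: indicates_not it.
- by move=> phi psi _ [t it] _ [u iu]; eexists; apply: indicates_and it iu.
- by move=> phi psi _ [t it] _ [u iu]; eexists; apply: indicates_or it iu.
- by move=> phi psi _ [t it] _ [u iu]; eexists; apply: indicates_imp it iu.
- by move=> phi psi _ [t it] _ [u iu]; eexists; apply: indicates_iff it iu.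
- by move=> x y phi nxy _ [t it]; eexists; apply: indicates_ex nxy it.
- by move=> x y phi nxy _ [t it]; eexists; apply: indicates_all nxy it.
Qed.

End Indicators.

Theorem proposition13 (L : language) (M : structure L)
    (le plus delta : funsym L 2) (G : varsym L)
    (no_relsym : forall n : nat, relsym L n -> False)
    (plusM : forall m n : nat, funM M plus [tuple m; n] = (m + n)%N)
    (leM : forall m n : nat,
       funM M le [tuple m; n] = if (m <= n)%N then 1%N else 0%N)
    (deltaM : forall m n : nat,
       funM M delta [tuple m; n] = if m == n then 1%N else 0%N)
    (GM : forall (m0 : nat) (ms : seq nat),
       varM M G (m0 :: ms) =
       if has (fun m => m != 0%N) (m0 :: ms) then 1%N else 0%N)
    (phi : formula L) :
  uqf le phi ->
  exists psi : formula L,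
    [/\ quantifier_free psi, FV psi = FV phi & models M (FIff phi psi)].
Proof.
move=> uqf_phi.
have [t [Et it]] := uqf_indicated plusM leM deltaM GM no_relsym uqf_phi.
exists (FEq t (TNum 1)); split; first exact: QF_atomic.
  by rewrite /= fsetU0.
by move=> s; rewrite /= interp_num; have [b -> ->] := it s; case: (b).
Qed.
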